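(* Over GBC, the principle $\mathrm{ETR}_{\mathrm{Ord}}$ implies that every class forcing notion $\mathbb P$ admits a forcing relation for atomic formulas.
   Context: GBC: Gödel–Bernays set theory with global choice. A class forcing notion is a separative class pre-order $\mathbb P$ with top $\mathbb 1$; $\mathbb P$-names are the usual set names. $\mathrm{ETR}_{\mathrm{Ord}}$: for every first-order formula $\varphi(x,X,A)$ and class $A$ there is a class $S\subseteq\mathrm{Ord}\times V$ with $S_\alpha=\{x:\varphi(x,S\restriction\alpha,A)\}$ for all ordinals $\alpha$, where $S_\alpha=\{x:\langle\alpha,x\rangle\in S\}$ and $S\restriction\alpha=S\cap(\alpha\times V)$. A forcing relation for atomic formulas consists of relations $p\Vdash\sigma\in\tau$, $p\Vdash\sigma\subseteq\tau$, $p\Vdash\sigma=\tau$ (for all $p\in\mathbb P$ and names $\sigma,\tau$) such that: (a) $p\Vdash\sigma\in\tau$ iff there is a dense class of $q\le p$ for which there is $\langle\rho,r\rangle\in\tau$ with $q\le r$ and $q\Vdash\sigma=\rho$; (b) $p\Vdash\sigma=\tau$ iff $p\Vdash\sigma\subseteq\tau$ and $p\Vdash\tau\subseteq\sigma$; (c) $p\Vdash\sigma\subseteq\tau$ iff whenever $\langle\rho,r\rangle\in\sigma$ and $q'\le p,r$, there is $q\le q'$ with $q\Vdash\rho\in\tau$. *)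

(* Defs.v *)
From Stdlib Require Import Setoid.

Set Implicit Arguments.
Unset Strict Implicit.

(* Two-sorted structures for the language of second-order set theory.  The
   structure is arbitrary: its membership may be ill-founded and its naturals
   nonstandard, so every recursive notion below is formulated internally. *)

Record structure : Type := Structure {
  vset : Type;
  vclass : Type;
  mem : vset -> vset -> Prop;
  cmem : vset -> vclass -> Prop }.

Arguments mem {s} x y.
Arguments cmem {s} x A.

Declare Scope gbc_scope.
Delimit Scope gbc_scope with gbc.
Notation "x ∈ y" := (mem x y) (at level 70, no associativity) : gbc_scope.
Notation "x ∈c A" := (cmem x A) (at level 70, no associativity) : gbc_scope.
Local Open Scope gbc_scope.

(* First-order formulas: quantifiers range over sets only.  [I] indexes the free
   set variables and [J] the (never bound) class variables; under a quantifier
   the bound variable is [None] and the outer variable [i] becomes [Some i]. *)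

Inductive fml (J I : Type) : Type :=
| FMem (i j : I)
| FEq (i j : I)
| FCMem (i : I) (A : J)
| FFalse
| FImp (p q : fml J I)
| FAnd (p q : fml J I)
| FOr (p q : fml J I)
| FAll (p : fml J (option I))
| FEx (p : fml J (option I)).

Arguments FFalse {J I}.
Arguments FMem {J I} i j.
Arguments FEq {J I} i j.

Definition scons {I X : Type} (x : X) (e : I -> X) (i : option I) : X :=
  match i with None => x | Some i => e i end.

(* A class variable is interpreted by a predicate, which need not be a class of
   [M]; as classes are not quantified, only membership in them matters. *)
Fixpoint sat {M : structure} {J I : Type} (C : J -> vset M -> Prop)
    (e : I -> vset M) (p : fml J I) {struct p} : Prop :=
  match p with
  | FMem i j => e i ∈ e j
  | FEq i j => e i = e j
  | FCMem i A => C A (e i)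
  | FFalse => False
  | FImp p q => sat C e p -> sat C e q
  | FAnd p q => sat C e p /\ sat C e q
  | FOr p q => sat C e p \/ sat C e q
  | FAll p => forall x, sat C (scons x e) p
  | FEx p => exists x, sat C (scons x e) p
  end.

Section InStructure.
Variable M : structure.
Notation V := (vset M).
Notation Cl := (vclass M).

Definition is_upair (z a b : V) : Prop := forall w, w ∈ z <-> w = a \/ w = b.

(* Kuratowski: z = {{a}, {a, b}}. *)
Definition is_opair (z a b : V) : Prop :=
  exists u v, is_upair u a a /\ is_upair v a b /\ is_upair z u v.

Definition rel (R : Cl) (a b : V) : Prop := exists z, is_opair z a b /\ z ∈c R.

Definition rel3 (R : Cl) (a b c : V) : Prop :=
  exists z, is_opair z b c /\ rel R a z.

Definition functional (F : Cl) : Prop :=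
  forall x y y', rel F x y -> rel F x y' -> y = y'.

(* In [comprehension] the parameters are the values of the free variables other
   than [None]; [I] and [J] are arbitrary, but a formula mentions only finitely
   many variables.  [replacement] allows partial class functions, and so yields
   separation. *)
Record GBC : Prop := {
  set_extensionality : forall x y : V, (forall z, z ∈ x <-> z ∈ y) -> x = y;
  class_extensionality : forall A B : Cl, (forall z, z ∈c A <-> z ∈c B) -> A = B;
  pairing : forall a b : V, exists z, is_upair z a b;
  union : forall a : V, exists u, forall z, z ∈ u <-> exists y, y ∈ a /\ z ∈ y;
  power_set : forall a : V,
    exists b, forall x, x ∈ b <-> forall z, z ∈ x -> z ∈ a;
  infinity : exists w : V,
    (exists o, o ∈ w /\ forall z, ~ z ∈ o) /\
    (forall x, x ∈ w ->
       exists s, s ∈ w /\ forall z, z ∈ s <-> z ∈ x \/ z = x);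
  foundation : forall A : Cl, (exists x, x ∈c A) ->
    exists x, x ∈c A /\ forall y, y ∈ x -> ~ y ∈c A;
  comprehension : forall (I J : Type) (p : fml J (option I))
      (e : I -> V) (C : J -> Cl),
    exists A : Cl, forall x,
      x ∈c A <-> sat (fun j z => z ∈c C j) (scons x e) p;
  replacement : forall F : Cl, functional F -> forall a : V,
    exists b, forall y, y ∈ b <-> exists x, x ∈ a /\ rel F x y;
  global_choice : exists F : Cl, functional F /\
    forall x : V, (exists y, y ∈ x) -> exists y, y ∈ x /\ rel F x y }.

Definition is_ordinal (a : V) : Prop :=
  (forall x y, x ∈ a -> y ∈ x -> y ∈ a) /\
  (forall x, x ∈ a -> ~ x ∈ x) /\
  (forall x y z, x ∈ a -> y ∈ a -> z ∈ a -> x ∈ y -> y ∈ z -> x ∈ z) /\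
  (forall x y, x ∈ a -> y ∈ a -> x ∈ y \/ x = y \/ y ∈ x) /\
  (forall s, (forall x, x ∈ s -> x ∈ a) -> (exists x, x ∈ s) ->
     exists x, x ∈ s /\ forall y, y ∈ s -> ~ y ∈ x).

Inductive etr_var : Type := varX | varA.

Definition restriction (S : Cl) (a : V) (z : V) : Prop :=
  z ∈c S /\ exists b x, b ∈ a /\ is_opair z b x.

Definition ETR_Ord : Prop :=
  forall (phi : fml etr_var unit) (A : Cl),
  exists S : Cl,
    (forall z, z ∈c S -> exists a x, is_ordinal a /\ is_opair z a x) /\
    (forall a, is_ordinal a -> forall x,
       rel S a x <->
       sat (fun v => match v with
                     | varX => restriction S a
                     | varA => fun z => z ∈c A
                     end)
           (fun _ : unit => x) phi).

Section Forcing.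
Variables (P LE : Cl) (one : V).

Definition incompatible (p q : V) : Prop :=
  ~ exists r, r ∈c P /\ rel LE r p /\ rel LE r q.

Definition class_forcing_notion : Prop :=
  (forall z, z ∈c LE -> exists p q, p ∈c P /\ q ∈c P /\ is_opair z p q) /\
  (forall p, p ∈c P -> rel LE p p) /\
  (forall p q r, p ∈c P -> q ∈c P -> r ∈c P ->
     rel LE p q -> rel LE q r -> rel LE p r) /\
  (one ∈c P /\ forall p, p ∈c P -> rel LE p one) /\
  (forall p q, p ∈c P -> q ∈c P -> ~ rel LE p q ->
     exists r, r ∈c P /\ rel LE r p /\ incompatible r q).

Definition hereditary_names (T : V) : Prop :=
  forall t, t ∈ T -> forall z, z ∈ t ->
    exists r p, r ∈ T /\ p ∈c P /\ is_opair z r p.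

(* The solution of "s is a name iff all its elements are pairs <r, p> with r a
   name and p in P", internal to M; see [is_name_rec] for this equation. *)
Definition is_name (s : V) : Prop := exists T, s ∈ T /\ hereditary_names T.

Definition dense_below (p : V) (D : Cl) : Prop :=
  (forall q, q ∈c D -> q ∈c P /\ rel LE q p) /\
  (forall p', p' ∈c P -> rel LE p' p -> exists q, q ∈c D /\ rel LE q p').

(* [rel3 FIn p s t], [rel3 FSub p s t] and [rel3 FEq p s t] say that p forces
   s in t, s included in t, and s = t respectively. *)
Definition atomic_forcing_relation (FIn FSub FEq : Cl) : Prop :=
  forall p s t, p ∈c P -> is_name s -> is_name t ->
  (rel3 FIn p s t <->
     exists D, dense_below p D /\
       forall q, q ∈c D -> exists r c z,
         is_opair z r c /\ z ∈ t /\ rel LE q c /\ rel3 FEq q s r) /\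
  (rel3 FEq p s t <-> rel3 FSub p s t /\ rel3 FSub p t s) /\
  (rel3 FSub p s t <->
     forall r c z q', is_opair z r c -> z ∈ s ->
       q' ∈c P -> rel LE q' p -> rel LE q' c ->
       exists q, q ∈c P /\ rel LE q q' /\ rel3 FIn q r t).

Definition admits_atomic_forcing_relation : Prop :=
  exists FIn FSub FEq : Cl, atomic_forcing_relation FIn FSub FEq.

End Forcing.
End InStructure.

Arguments GBC M : clear implicits.
Arguments ETR_Ord M : clear implicits.

(* Adequacy of [is_name]. *)

Definition FIff {J I} (p q : fml J I) := FAnd (FImp p q) (FImp q p).
Definition FUpair {J I} (z a b : I) : fml J I :=
  FAll (FIff (FMem None (Some z))
             (FOr (FEq None (Some a)) (FEq None (Some b)))).
Definition FOpair {J I} (z a b : I) : fml J I :=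
  FEx (FEx (FAnd (FUpair (Some None) (Some (Some a)) (Some (Some a)))
           (FAnd (FUpair None (Some (Some a)) (Some (Some b)))
                 (FUpair (Some (Some z)) (Some None) None)))).

Section NameRec.
Variable M : structure.
Hypothesis G : GBC M.
Notation V := (vset M).
Notation Cl := (vclass M).

Lemma sat_FOpair J I (C : J -> V -> Prop) (e : I -> V) z a b :
  sat C e (FOpair z a b) <-> is_opair (e z) (e a) (e b).
Proof. reflexivity. Qed.

Lemma is_upair_inj z a b c d : is_upair (M := M) z a b -> is_upair z c d ->
  (a = c /\ b = d) \/ (a = d /\ b = c).
Proof.
intros H K.
assert (Ha : a = c \/ a = d) by (apply K, H; auto).
assert (Hb : b = c \/ b = d) by (apply K, H; auto).
assert (Hc : c = a \/ c = b) by (apply H, K; auto).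
assert (Hd : d = a \/ d = b) by (apply H, K; auto).
destruct Ha, Hb, Hc, Hd; subst; auto.
Qed.

Lemma is_opair_inj z a b c d : is_opair (M := M) z a b -> is_opair z c d ->
  a = c /\ b = d.
Proof.
intros (u & v & Hu & Hv & Hz) (u' & v' & Hu' & Hv' & Hz').
destruct (is_upair_inj Hz Hz') as [[E1 E2]|[E1 E2]]; subst.
- destruct (is_upair_inj Hu Hu') as [[? _]|[? _]];
  destruct (is_upair_inj Hv Hv') as [[? ?]|[? ?]]; subst; auto.
- destruct (is_upair_inj Hu Hv') as [[? ?]|[? ?]];
  destruct (is_upair_inj Hv Hu') as [[? ?]|[? ?]]; subst; auto.
Qed.

Lemma opair_exists (a b : V) : exists z, is_opair z a b.
Proof.
destruct (pairing G a a) as [u Hu], (pairing G a b) as [v Hv].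
destruct (pairing G u v) as [z Hz]; exists z, u, v; auto.
Qed.

Lemma is_opair_fun z z' a b : is_opair (M := M) z a b -> is_opair z' a b ->
  z = z'.
Proof.
intros (u & v & Hu & Hv & Hz) (u' & v' & Hu' & Hv' & Hz').
assert (E : u = u').
{ apply (set_extensionality G); intro w; rewrite (Hu w), (Hu' w); tauto. }
assert (E' : v = v').
{ apply (set_extensionality G); intro w; rewrite (Hv w), (Hv' w); tauto. }
subst; apply (set_extensionality G); intro w; rewrite (Hz w), (Hz' w); tauto.
Qed.

(* Formulas whose parameters are the elements of [M] themselves. *)
Notation sat0 := (sat (fun (A : Cl) z => z ∈c A)).

Lemma separation (p : fml Cl (option V)) (a : V) :
  exists b, forall x, x ∈ b <-> x ∈ a /\ sat0 (scons x (fun v => v)) p.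
Proof.
destruct (comprehension G p (fun v => v) (fun A => A)) as [C HC].
set (q := FEx (FAnd (FOpair (Some None) None None) (FCMem None C))
          : fml Cl (option V)).
destruct (comprehension G q (fun v => v) (fun A => A)) as [D HD].
assert (RD : forall x y, rel D x y <-> x = y /\ x ∈c C).
{ intros x y; split.
  - intros (z & Hz & HzD); apply HD in HzD; destruct HzD as (w & Hw & HwC).
    apply sat_FOpair in Hw; simpl in Hw, HwC.
    destruct (is_opair_inj Hz Hw); subst; auto.
  - intros [<- Hx]; destruct (opair_exists x x) as [z Hz]; exists z.
    split; auto; apply HD; exists x; split; auto; apply sat_FOpair; auto. }
assert (FD : functional D).
{ intros x y y' H H'; apply RD in H; apply RD in H'.
  destruct H as [<- _], H' as [<- _]; auto. }
destruct (replacement G FD a) as [b Hb]; exists b; intro x.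
rewrite (Hb x); split.
- intros (y & Hy & R); apply RD in R; destruct R as [-> R].
  split; auto; apply HC; auto.
- intros [Hx H]; exists x; split; auto; apply RD; split; auto; apply HC; auto.
Qed.

Variable P : Cl.

Definition FHer {I} (T : I) : fml Cl I :=
  FAll (FImp (FMem None (Some T))
  (FAll (FImp (FMem None (Some None))
  (FEx (FEx (FAnd (FMem (Some None) (Some (Some (Some (Some T)))))
            (FAnd (FCMem None P)
                  (FOpair (Some (Some None)) (Some None) None)))))))).

Definition least_witness (s h : V) : Prop :=
  s ∈ h /\ hereditary_names P h /\
  forall T, s ∈ T -> hereditary_names P T -> forall x, x ∈ h -> x ∈ T.

Lemma least_witness_exists s : is_name P s -> exists h, least_witness s h.
Proof.
intros (T & HsT & HT).
set (p := FAll (FImp (FMem (Some (Some s)) None)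
               (FImp (FHer None) (FMem (Some None) None)))
          : fml Cl (option V)).
destruct (separation p T) as [h Hh].
assert (E : forall x, x ∈ h <-> x ∈ T /\
   forall T', s ∈ T' -> hereditary_names P T' -> x ∈ T') by exact Hh.
exists h; split; [|split].
- apply E; auto.
- intros t Ht z Hz; apply E in Ht; destruct Ht as [Ht Ht'].
  destruct (HT t Ht z Hz) as (r & c & Hr & Hc & Hz').
  exists r, c; split; auto; apply E; split; auto.
  intros T' HsT' HT'; destruct (HT' t (Ht' T' HsT' HT') z Hz)
    as (r' & c' & Hr' & _ & Hz'').
  destruct (is_opair_inj Hz' Hz''); subst; auto.
- intros T' HsT' HT' x Hx; apply E in Hx; destruct Hx as [_ Hx]; auto.
Qed.

Theorem is_name_rec (s : V) :
  is_name P s <->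
  forall z, z ∈ s -> exists r p, is_name P r /\ p ∈c P /\ is_opair z r p.
Proof.
split.
{ intros (T & HsT & HT) z Hz; destruct (HT s HsT z Hz) as (r & p & Hr & Hp & Hz').
  exists r, p; split; auto; exists T; auto. }
intro Hs.
(* w = <y, h> with y = <r, c> and h the least witness of r *)
set (q :=
  FEx (FEx (FEx (FEx
   (FAnd (FOpair (Some (Some (Some (Some None)))) (Some (Some (Some None)))
                 (Some (Some None)))
   (FAnd (FOpair (Some (Some (Some None))) (Some None) None)
   (FAnd (FMem (Some None) (Some (Some None)))
   (FAnd (FHer (Some (Some None)))
   (FAll (FImp (FMem (Some (Some None)) None) (FImp (FHer None)
     (FAll (FImp (FMem None (Some (Some (Some (Some None)))))
                 (FMem None (Some None)))))))))))))) : fml Cl (option V)).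
destruct (comprehension G q (fun v => v) (fun A => A)) as [F HF].
assert (RF : forall y h, rel F y h <->
   exists r c, is_opair y r c /\ least_witness r h).
{ intros y h; split.
  - intros (w & Hw & HwF); apply HF in HwF.
    destruct HwF as (y' & h' & r & c & H1 & H2 & H3 & H4 & H5).
    apply sat_FOpair in H1; simpl in H1.
    destruct (is_opair_inj Hw H1); subst y' h'.
    exists r, c; split; [exact H2|]; split; [exact H3|]; split; [exact H4|].
    exact H5.
  - intros (r & c & Hy & H3 & H4 & H5).
    destruct (opair_exists y h) as [w Hw]; exists w; split; auto.
    apply HF; exists y, h, r, c; split; [exact Hw|]; split; [exact Hy|].
    split; [exact H3|]; split; [exact H4|].
    exact H5. }
assert (FF : functional F).
{ intros y h h' H H'; apply RF in H; apply RF in H'.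
  destruct H as (r & c & Hy & A1 & A2 & A3), H' as (r' & c' & Hy' & B1 & B2 & B3).
  destruct (is_opair_inj Hy Hy'); subst r' c'.
  apply (set_extensionality G); intro x; split; auto. }
destruct (replacement G FF s) as [b Hb], (union G b) as [u Hu].
destruct (pairing G s s) as [s1 Hs1], (pairing G u s1) as [m Hm].
destruct (union G m) as [T HT].
assert (E : forall x, x ∈ T <-> x = s \/
   exists y h r c, y ∈ s /\ is_opair y r c /\ least_witness r h /\ x ∈ h).
{ intro x; rewrite (HT x); split.
  - intros (k & Hk & Hx); apply Hm in Hk; destruct Hk as [-> | ->].
    + apply Hu in Hx; destruct Hx as (h & Hh & Hx); right.
      apply Hb in Hh; destruct Hh as (y & Hy & R); apply RF in R.
      destruct R as (r & c & H1 & H2); exists y, h, r, c; auto.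
    + left; apply Hs1 in Hx; destruct Hx; auto.
  - intros [-> | (y & h & r & c & H1 & H2 & H3 & H4)].
    + exists s1; split; [apply Hm | apply Hs1]; auto.
    + exists u; split; [apply Hm; auto|apply Hu].
      exists h; split; auto; apply Hb; exists y; split; auto.
      apply RF; exists r, c; auto. }
exists T; split; [apply E; auto|].
intros t Ht z Hz; apply E in Ht.
destruct Ht as [-> | (y & h & r & c & H1 & H2 & H3 & H4)].
- destruct (Hs z Hz) as (r & p & Hr & Hp & Hz').
  destruct (least_witness_exists Hr) as [h Hh].
  exists r, p; split; auto; apply E; right; exists z, h, r, p.
  split; [exact Hz|]; split; [exact Hz'|]; split; [exact Hh|]; exact (proj1 Hh).
- pose proof (proj1 (proj2 H3)) as K.
  destruct (K t H4 z Hz) as (r' & p & Hr' & Hp & Hz').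
  exists r', p; split; auto; apply E; right; exists y, h, r, c; auto.
Qed.

End NameRec.

(* Main.v *)
(* Unfolding clauses (a)-(c), [p ⊩ σ ⊆ τ] is expressed through the statements
   [q ⊩ ρ ⊆ ρ'] and [q ⊩ ρ' ⊆ ρ] with [ρ ∈ dom σ] and [ρ' ∈ dom τ], by an
   operator that is monotone in the relation ⊆.  ETR_Ord iterates this operator
   along the ordinals: stage α is the operator applied to the union of the
   earlier stages.  The union of all stages is a fixed point because, by
   ∈-induction and replacement, each σ has an ordinal α such that every true
   statement [p ⊩ σ ⊆ τ] or [p ⊩ τ ⊆ σ], for any p and τ, already holds at
   stage α. *)

Require Import Defs.
From Stdlib Require Import Classical.

Set Implicit Arguments.
Unset Strict Implicit.
Local Open Scope gbc_scope.

Local Notation "# i" := (Some i) (at level 0, i at level 0, format "# i").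

(** * Formulas for ordinals, coded triples and the forcing operator *)

Definition transitive_set {M : structure} (a : vset M) : Prop :=
  forall x y, x ∈ a -> y ∈ x -> y ∈ a.

(** The short form of ordinal under foundation, see [is_ordinalE]; it keeps the formulas below
    small. *)
Definition hereditarily_transitive {M : structure} (a : vset M) : Prop :=
  transitive_set a /\ forall x, x ∈ a -> transitive_set x.

(** Convertible with [rel3] when [R] is membership in a class; a general predicate also covers
    sections and restrictions of the recursion class. *)
Definition triple_in {M : structure} (R : vset M -> Prop) (a b c : vset M) : Prop :=
  exists y, is_opair y b c /\ exists x, is_opair x a y /\ R x.

Section Formulas.
Context {J I : Type}.

Definition FTransitive (a : I) : fml J I :=
  FAll (FAll (FImp (FMem #None ##a) (FImp (FMem None #None) (FMem None ##a)))).

Definition FHerTransitive (a : I) : fml J I :=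
  FAnd (FTransitive a)
       (FAll (FImp (FMem None #a)
          (FAll (FAll (FImp (FMem #None ##None)
                      (FImp (FMem None #None) (FMem None ##None))))))).

Definition FRel (A : J) (a b : I) : fml J I :=
  FEx (FAnd (FOpair None #a #b) (FCMem None A)).

Definition FTripleIn (R : fml J (option (option I))) (a b c : I) : fml J I :=
  FEx (FAnd (FOpair None #b #c) (FEx (FAnd (FOpair None ##a #None) R))).

End Formulas.

(** [E] is polymorphic in the variable type because it is instantiated below five further
    quantifiers. *)
Definition FForcesIn {J} (LE : J) (E : forall I, I -> I -> I -> fml J I)
    {I} (q s t : I) : fml J I :=
  FAll (FImp (FRel LE None #q)
  (FEx (FAnd (FRel LE None #None)
  (FEx (FEx (FEx
    (FAnd (FOpair None ##None #None)
    (FAnd (FMem None #####t)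
    (FAnd (FRel LE ###None #None)
    (FAnd (E _ ###None #####s ##None)
          (E _ ###None ##None #####s))))))))))).

Definition FForcesSub {J} (LE : J) (E : forall I, I -> I -> I -> fml J I)
    {I} (p s t : I) : fml J I :=
  FAll (FAll (FAll (FAll
    (FImp (FOpair #None ###None ##None)
    (FImp (FMem #None ####s)
    (FImp (FRel LE None ####p)
    (FImp (FRel LE None ##None)
    (FEx (FAnd (FRel LE None #None)
               (FForcesIn LE E None ####None #####t)))))))))).

Definition FEarlier (I : Type) (q a b : I) : fml etr_var I :=
  FTripleIn (FEx (FRel varX None #None)) q a b.

(** The formula given to [ETR_Ord]. Its one free set variable holds the coded triple of [p], [s],
    [t]; the four quantifiers decode it, binding the pair of names, [s], [t] and [p] in this
    order. *)
Definition FSubStage : fml etr_var unit :=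
  FEx (FEx (FEx (FEx
    (FAnd (FOpair ###None ##None #None)
    (FAnd (FOpair ####tt None ###None)
          (FForcesSub varA FEarlier None ##None #None)))))).

(** * Classes from formulas, coded tuples and ∈-induction *)

Section Model.
Variable M : structure.
Hypothesis G : GBC M.
Notation V := (vset M).
Notation Cl := (vclass M).
Notation sat0 := (sat (fun (A : Cl) z => z ∈c A)).

Lemma class_of (p : fml Cl (option V)) :
  exists A : Cl, forall x, x ∈c A <-> sat0 (scons x (fun v => v)) p.
Proof. exact (comprehension G p (fun v => v) (fun A => A)). Qed.

(* In [rel_class] and [rel3_class] the variables of [p] below the arguments of
   [Q] are the codes [w], [u] of the tuple, on which [p] must not depend. *)
Lemma rel_class (Q : V -> V -> Prop) (p : fml Cl (option (option (option V)))) :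
  (forall w x y, sat0 (scons y (scons x (scons w (fun v => v)))) p <-> Q x y) ->
  exists R : Cl, forall x y, rel R x y <-> Q x y.
Proof.
intro H.
destruct (class_of (FEx (FEx (FAnd (FOpair ##None #None None) p)))) as [R HR].
exists R; intros x y; split.
- intros (w & Hw & K); apply HR in K; destruct K as (x' & y' & Hw' & K).
  apply H in K; apply sat_FOpair in Hw'; simpl in Hw'.
  destruct (is_opair_inj Hw Hw'); subst; exact K.
- intro K; destruct (opair_exists G x y) as [w Hw]; exists w; split; auto.
  apply HR; exists x, y; split; [exact Hw | apply H; exact K].
Qed.

Lemma triple_in_triple (R : V -> Prop) a b c x y :
  is_opair y b c -> is_opair x a y -> triple_in R a b c <-> R x.
Proof.
intros Hy Hx; split.
- intros (y' & Hy' & x' & Hx' & K).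
  rewrite (is_opair_fun G Hy' Hy) in Hx'.
  rewrite (is_opair_fun G Hx' Hx) in K; exact K.
- intro K; exists y; split; auto; exists x; auto.
Qed.

Lemma rel3_class (Q : V -> V -> V -> Prop)
    (p : fml Cl (option (option (option (option (option V)))))) :
  (forall u w x y z,
     sat0 (scons z (scons y (scons x (scons w (scons u (fun v => v)))))) p
     <-> Q x y z) ->
  exists R : Cl, forall x y z, rel3 R x y z <-> Q x y z.
Proof.
intro H.
destruct (class_of (FEx (FEx (FEx (FEx (FAnd (FOpair ###None #None None)
  (FAnd (FOpair ####None ##None ###None) p))))))) as [R HR].
exists R; intros x y z.
destruct (opair_exists G y z) as [w Hw], (opair_exists G x w) as [u Hu].
rewrite <- (H u w x y z).
transitivity (u ∈c R);
  [exact (triple_in_triple (fun v => v ∈c R) Hw Hu) | rewrite (HR u); split].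
- intros (w' & x' & y' & z' & Hw' & Hu' & K).
  apply sat_FOpair in Hw'; apply sat_FOpair in Hu'; simpl in Hw', Hu'.
  destruct (is_opair_inj Hu Hu'); subst.
  destruct (is_opair_inj Hw Hw'); subst; exact K.
- intro K; exists w, x, y, z; split; [exact Hw | split; [exact Hu | exact K]].
Qed.

(** Foundation applied to the complement of [A]. Induction is available for classes, so later uses
    first present the property by a formula. *)
Lemma mem_induction (A : Cl) :
  (forall x, (forall y, y ∈ x -> y ∈c A) -> x ∈c A) -> forall x, x ∈c A.
Proof.
intros H x; apply NNPP; intro K.
destruct (class_of (FImp (FCMem None A) FFalse)) as [B HB].
destruct (foundation G (A := B)) as (m & Hm & Hmin).
- exists x; apply HB; exact K.
- apply HB in Hm; apply Hm, H; intros y Hy.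
  apply NNPP; intro Ky; apply (Hmin y Hy); apply HB; exact Ky.
Qed.

(* The first component of a Kuratowski pair in [x] lies three steps below [x]. *)
Lemma pair_induction (A : Cl) :
  (forall x, (forall y u z, y ∈ u -> u ∈ z -> z ∈ x -> y ∈c A) -> x ∈c A) ->
  forall x, x ∈c A.
Proof.
intros H x.
(* [B] asks for membership in [A] of a set, its elements and their elements, so one step of
   ∈-induction on [B] reaches three levels down. *)
destruct (class_of (FAnd (FCMem None A)
   (FAll (FImp (FMem None #None) (FAnd (FCMem None A)
     (FAll (FImp (FMem None #None) (FCMem None A)))))))) as [B HB].
assert (E : forall x, x ∈c B <-> x ∈c A /\
  forall y, y ∈ x -> y ∈c A /\ forall u, u ∈ y -> u ∈c A) by exact HB.
cut (x ∈c B); [intro K; exact (proj1 (proj1 (E x) K))|].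
revert x; apply mem_induction; intros x Hx; apply E; split.
- apply H; intros y u z Hy Hu Hz.
  exact (proj2 (proj2 (proj1 (E z) (Hx z Hz)) u Hu) y Hy).
- intros y Hy; destruct (proj1 (E y) (Hx y Hy)) as [H1 H2]; split; auto.
  intros u Hu; exact (proj1 (H2 u Hu)).
Qed.

(** * Ordinals and collection of ordinals *)

Lemma mem_irreflexive (x : V) : ~ x ∈ x.
Proof.
destruct (class_of (FImp (FMem None None) FFalse)) as [A HA].
assert (E : forall x, x ∈c A <-> ~ x ∈ x) by exact HA.
apply E; revert x; apply mem_induction; intros y Hy; apply E; intro K.
exact (proj1 (E y) (Hy y K) K).
Qed.

Lemma hereditarily_transitive_mem (a x : V) :
  hereditarily_transitive a -> x ∈ a -> hereditarily_transitive x.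
Proof. intros [H1 H2] Hx; split; eauto. Qed.

(** Double ∈-induction, on [a] and then on [b]: if neither is an element of the other, the two
    induction hypotheses show that they have the same elements. *)
Lemma hereditarily_transitive_total (a b : V) :
  hereditarily_transitive a -> hereditarily_transitive b ->
  a ∈ b \/ a = b \/ b ∈ a.
Proof.
destruct (class_of (FImp (FHerTransitive None) (FAll (FImp (FHerTransitive None)
  (FOr (FMem #None None) (FOr (FEq #None None) (FMem None #None)))))))
  as [A HA].
assert (EA : forall a, a ∈c A <-> (hereditarily_transitive a ->
  forall b, hereditarily_transitive b -> a ∈ b \/ a = b \/ b ∈ a)) by exact HA.
intro Ha; revert b; revert Ha; apply EA; revert a; apply mem_induction.
intros a IHa; apply EA; intros Ha b.
destruct (class_of (FImp (FHerTransitive None)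
  (FOr (FMem #a None) (FOr (FEq #a None) (FMem None #a))))) as [B HB].
assert (EB : forall b, b ∈c B <-> (hereditarily_transitive b ->
  a ∈ b \/ a = b \/ b ∈ a)) by exact HB.
revert b; cut (forall b, b ∈c B); [intros K b; exact (proj1 (EB b) (K b))|].
apply mem_induction; intros b IHb; apply EB; intros Hb.
apply NNPP; intro K; apply K; right; left.
apply (set_extensionality G); intro x; split; intro Hx.
- destruct (proj1 (EA x) (IHa x Hx) (hereditarily_transitive_mem Ha Hx) b Hb)
    as [H | [-> | H]]; auto.
  + destruct K; auto.
  + destruct K; right; right; exact (proj1 Ha _ _ Hx H).
- destruct (proj1 (EB x) (IHb x Hx) (hereditarily_transitive_mem Hb Hx))
    as [H | [<- | H]]; auto.
  + destruct K; left; exact (proj1 Hb _ _ Hx H).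
  + destruct K; auto.
Qed.

Lemma is_ordinalE (a : V) : is_ordinal a <-> hereditarily_transitive a.
Proof.
split.
- intros (H1 & _ & H3 & _); split; [exact H1|].
  intros x Hx y z Hy Hz; apply (H3 z y x); eauto.
- intro H; split; [exact (proj1 H)|]; split; [|split; [|split]].
  + intros x _; apply mem_irreflexive.
  + intros x y z _ _ Hz Hxy Hyz; exact (proj2 H z Hz y x Hyz Hxy).
  + intros x y Hx Hy; apply hereditarily_transitive_total;
      eapply hereditarily_transitive_mem; eauto.
  + intros s _ Hs; destruct (class_of (FMem None #s)) as [A HA].
    destruct (foundation G (A := A)) as (m & Hm & Hmin).
    * destruct Hs as [x Hx]; exists x; apply HA; exact Hx.
    * exists m; split; [apply HA; exact Hm|].
      intros y Hy Hym; apply (Hmin y Hym), HA; exact Hy.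
Qed.

(** The bound is b ∪ ⋃b. *)
Lemma ordinal_above (b : V) : (forall x, x ∈ b -> is_ordinal x) ->
  exists l, is_ordinal l /\ forall x, x ∈ b -> x ∈ l.
Proof.
intro H; destruct (union G b) as [u Hu], (pairing G b u) as [m Hm].
destruct (union G m) as [l Hl].
assert (E : forall x, x ∈ l <-> x ∈ b \/ exists y, y ∈ b /\ x ∈ y).
{ intro x; rewrite (Hl x); split.
  - intros (k & Hk & Hx); apply Hm in Hk; destruct Hk as [-> | ->]; auto.
    right; apply Hu; exact Hx.
  - intros [Hx | Hx]; [exists b | exists u]; split; auto; try (apply Hm; auto).
    apply Hu; exact Hx. }
exists l; split; [apply is_ordinalE; split|].
- intros x y Hx Hy; apply E; right; apply E in Hx; destruct Hx as [Hx | (k & Hk & Hx)].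
  + exists x; auto.
  + exists k; split; auto; apply H, is_ordinalE in Hk; exact (proj1 Hk x y Hx Hy).
- intros x Hx; apply E in Hx; destruct Hx as [Hx | (k & Hk & Hx)].
  + apply H, is_ordinalE in Hx; exact (proj1 Hx).
  + apply H, is_ordinalE in Hk; exact (proj2 Hk x Hx).
- intros x Hx; apply E; auto.
Qed.

Lemma ordinal_collection (R : Cl) (a : V) :
  (forall x, x ∈ a -> exists o, is_ordinal o /\ rel R x o) ->
  exists l, is_ordinal l /\ forall x, x ∈ a -> exists o, o ∈ l /\ rel R x o.
Proof.
intro H.
(* Passing to the least related ordinal makes the relation functional, so that replacement
   applies. *)
set (least x o := hereditarily_transitive o /\ rel R x o /\
       forall o', o' ∈ o -> ~ rel R x o').
destruct (@rel_class least (FAnd (FHerTransitive None) (FAnd (FRel R #None None)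
    (FAll (FImp (FMem None #None) (FImp (FRel R ##None None) FFalse))))))
  as [F HF]; [intros; reflexivity|].
assert (FF : functional F).
{ intros x o o' K K'; apply HF in K; apply HF in K'.
  destruct K as (K1 & K2 & K3), K' as (K1' & K2' & K3').
  destruct (hereditarily_transitive_total K1 K1') as [L | [L | L]]; auto.
  - destruct (K3' o L K2).
  - destruct (K3 o' L K2'). }
destruct (replacement G FF a) as [b Hb].
destruct (@ordinal_above b) as (l & Hl & Hbl).
{ intros o Ho; apply Hb in Ho; destruct Ho as (x & _ & Ho); apply HF in Ho.
  apply is_ordinalE; exact (proj1 Ho). }
exists l; split; auto; intros x Hx; destruct (H x Hx) as (o & Ho & Ko).
destruct (class_of (FAnd (FHerTransitive None) (FRel R #x None))) as [A HA].
assert (EA : forall o, o ∈c A <-> hereditarily_transitive o /\ rel R x o)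
  by exact HA.
destruct (foundation G (A := A)) as (m & Hm & Hmin).
{ exists o; apply EA; split; auto; apply is_ordinalE; auto. }
apply EA in Hm; destruct Hm as [Hm Km]; exists m; split; auto.
apply Hbl, Hb; exists x; split; auto; apply HF; split; auto; split; auto.
intros o' Ho' K; apply (Hmin o' Ho'), EA; split; auto.
exact (hereditarily_transitive_mem Hm Ho').
Qed.

(** * The operator for inclusion and its monotonicity *)

Section Operator.
Variable LE : Cl.

(** Clause (a) with equality split into two inclusions by (b) and with density spelled out
    pointwise, so that no class is quantified. *)
Definition forces_in (E : V -> V -> V -> Prop) (q s t : V) : Prop :=
  forall q1, rel LE q1 q -> exists q2, rel LE q2 q1 /\
    exists r c z, is_opair z r c /\ z ∈ t /\ rel LE q2 c /\ E q2 s r /\ E q2 r s.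

Definition forces_sub (E : V -> V -> V -> Prop) (p s t : V) : Prop :=
  forall r c z q', is_opair z r c -> z ∈ s -> rel LE q' p -> rel LE q' c ->
    exists q, rel LE q q' /\ forces_in E q r t.

Definition name_dom (s r : V) : Prop := exists c z, is_opair z r c /\ z ∈ s.

(** [E] occurs only positively, and only between names from the domains of [s] and [t]. Comparing
    the relations just there lets a bound for the names in the domain of [s] suffice. *)
Lemma forces_sub_mono (E E' : V -> V -> V -> Prop) p s t :
  (forall q r r', name_dom s r -> name_dom t r' ->
     (E q r r' -> E' q r r') /\ (E q r' r -> E' q r' r)) ->
  forces_sub E p s t -> forces_sub E' p s t.
Proof.
intros H K r c z q' Hz Hzs Hp Hc; destruct (K r c z q' Hz Hzs Hp Hc) as (q & Hq & L).
exists q; split; auto; intros q1 Hq1; destruct (L q1 Hq1)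
  as (q2 & Hq2 & r' & c' & z' & Hz' & Hzt & Hc' & L1 & L2).
assert (Ds : name_dom s r) by (exists c, z; auto).
assert (Dt : name_dom t r') by (exists c', z'; auto).
destruct (H q2 r r' Ds Dt) as [H1 H2].
exists q2; split; auto; exists r', c', z'; repeat split; auto.
Qed.

(** The set ⋃⋃s contains the first components of the Kuratowski pairs in [s], and so gives a set on
    which to apply collection. *)
Lemma name_dom_set (s : V) : exists d, forall r, r ∈ d <->
  exists u z, r ∈ u /\ u ∈ z /\ z ∈ s.
Proof.
destruct (union G s) as [s1 H1], (union G s1) as [d Hd]; exists d; intro r.
rewrite (Hd r); split.
- intros (u & Hu & Hr); apply H1 in Hu; destruct Hu as (z & Hz & Hu).
  exists u, z; auto.
- intros (u & z & Hr & Hu & Hz); exists u; split; auto; apply H1; exists z; auto.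
Qed.

Lemma name_dom_below s r : name_dom s r -> exists u z, r ∈ u /\ u ∈ z /\ z ∈ s.
Proof.
intros (c & z & (u & v & Hu & Hv & Hz) & Hzs); exists u, z.
split; [apply Hu; auto | split; auto; apply Hz; auto].
Qed.

(** * Stages of the recursion and their union as a fixed point *)

Variable S : Cl.
Hypothesis S_ordinal :
  forall z, z ∈c S -> exists a x, is_ordinal a /\ is_opair z a x.
Hypothesis S_stage : forall a, is_ordinal a -> forall x,
  rel S a x <->
  sat (fun v => match v with
                | varX => restriction S a
                | varA => fun z => z ∈c LE
                end) (fun _ : unit => x) FSubStage.

Definition stage (a p s t : V) : Prop := triple_in (rel S a) p s t.

Definition earlier (a p s t : V) : Prop := exists b, b ∈ a /\ stage b p s t.

Definition some_stage (p s t : V) : Prop := exists a, is_ordinal a /\ stage a p s t.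

(** The left side is what satisfaction of [FEarlier] at stage [a] unfolds to; membership in the
    restriction forces the index below [a]. *)
Lemma earlierE a p s t :
  triple_in (fun x => exists b z, is_opair z b x /\ restriction S a z) p s t <->
  earlier a p s t.
Proof.
split.
- intros (y & Hy & x & Hx & b & z & Hz & HzS & b' & x' & Hb & Hz').
  destruct (is_opair_inj Hz Hz'); subst b' x'; exists b; split; auto.
  exists y; split; auto; exists x; split; auto; exists z; auto.
- intros (b & Hb & y & Hy & x & Hx & z & Hz & HzS).
  exists y; split; auto; exists x; split; auto; exists b, z; split; auto.
  split; auto; exists b, x; auto.
Qed.

Lemma stageE a p s t : is_ordinal a ->
  stage a p s t <-> forces_sub (earlier a) p s t.
Proof.
intro Ha.
destruct (opair_exists G s t) as [y Hy], (opair_exists G p y) as [x Hx].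
unfold stage; rewrite (triple_in_triple (rel S a) Hy Hx), (S_stage Ha x).
set (E := triple_in (fun x => exists b z, is_opair z b x /\ restriction S a z)).
(* Satisfaction of [FSubStage] is convertible with this statement. *)
transitivity (exists y s t p, is_opair y s t /\ is_opair x p y /\
  forces_sub E p s t); [exact (iff_refl _) | split].
- intros (y' & s' & t' & p' & Hy' & Hx' & K).
  destruct (is_opair_inj Hx Hx'); subst; destruct (is_opair_inj Hy Hy'); subst.
  revert K; apply forces_sub_mono; intros; split; apply earlierE.
- intro K; exists y, s, t, p; split; auto; split; auto.
  revert K; apply forces_sub_mono; intros; split; apply earlierE.
Qed.

Lemma some_stage_class :
  exists FSub : Cl, forall p s t, rel3 FSub p s t <-> some_stage p s t.
Proof.
destruct (class_of (FEx (FRel S None #None))) as [A HA]; exists A; intros p s t.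
destruct (opair_exists G s t) as [y Hy], (opair_exists G p y) as [x Hx].
transitivity (x ∈c A); [exact (triple_in_triple (fun v => v ∈c A) Hy Hx)|].
rewrite (HA x); split.
- intros (a & K); exists a.
  split; [|exact (proj2 (triple_in_triple (rel S a) Hy Hx) K)].
  destruct K as (z & Hz & HzS); destruct (S_ordinal HzS) as (a' & x' & Ha & Hz').
  destruct (is_opair_inj Hz Hz'); subst; exact Ha.
- intros (a & _ & K); exists a; exact (proj1 (triple_in_triple (rel S a) Hy Hx) K).
Qed.

(** The ordinal is uniform in [q] and [t], which range over all sets. Both orders are recorded
    because equality unfolds to inclusions in both directions. *)
Definition closure_stage (s a : V) : Prop := forall q t,
  (some_stage q s t -> stage a q s t) /\ (some_stage q t s -> stage a q t s).

Lemma some_stage_forces_sub p s t :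
  some_stage p s t -> forces_sub some_stage p s t.
Proof.
intros (a & Ha & K); apply (stageE p s t Ha) in K; revert K.
assert (H : forall q r r', earlier a q r r' -> some_stage q r r').
{ intros q r r' (b & Hb & L); exists b; split; auto.
  apply is_ordinalE in Ha.
  exact (proj2 (is_ordinalE b) (hereditarily_transitive_mem Ha Hb)). }
apply forces_sub_mono; auto.
Qed.

Lemma closure_stage_class :
  exists R : Cl, forall s a, rel R s a <-> closure_stage s a.
Proof.
destruct some_stage_class as [FSub HSub].
apply rel_class with (p := FAll (FAll (FAnd
   (FImp (FTripleIn (FCMem None FSub) #None ###None None)
         (FTripleIn (FRel S ####None None) #None ###None None))
   (FImp (FTripleIn (FCMem None FSub) #None None ###None)
         (FTripleIn (FRel S ####None None) #None None ###None))))).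
intros w s a.
transitivity (forall q t, (rel3 FSub q s t -> stage a q s t) /\
   (rel3 FSub q t s -> stage a q t s)); [exact (iff_refl _)|].
split; intros K q t; destruct (K q t) as [K1 K2];
  (split; intro L; [apply K1 | apply K2]); apply HSub; exact L.
Qed.

(** Collection over ⋃⋃s yields an [l] above a closure stage of each name in the domain of [s]; what
    ever holds about such a name thus holds before [l]. *)
Lemma earlier_name_dom s :
  (forall r u z, r ∈ u -> u ∈ z -> z ∈ s ->
     exists a, is_ordinal a /\ closure_stage r a) ->
  exists l, is_ordinal l /\ forall q r r', name_dom s r ->
    (some_stage q r r' -> earlier l q r r') /\
    (some_stage q r' r -> earlier l q r' r).
Proof.
intro H; destruct closure_stage_class as [R HR], (name_dom_set s) as [d Hd].
destruct (@ordinal_collection R d) as (l & Hl & K).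
{ intros r Hr; apply Hd in Hr; destruct Hr as (u & z & Hr & Hu & Hz).
  destruct (H r u z Hr Hu Hz) as (a & Ha & L); exists a; split; auto.
  apply HR; exact L. }
exists l; split; auto; intros q r r' Hr; destruct (K r) as (o & Ho & Ko).
{ apply Hd, name_dom_below; exact Hr. }
destruct (proj1 (HR r o) Ko q r') as [K1 K2]; split; intro N; exists o; auto.
Qed.

(** By [pair_induction]: an inclusion involving [s] unfolds to inclusions each involving a name from
    its domain; these hold before [l], so the original one holds at [l]. *)
Lemma closure_stage_exists s : exists a, is_ordinal a /\ closure_stage s a.
Proof.
destruct closure_stage_class as [R HR].
destruct (class_of (FEx (FAnd (FHerTransitive None) (FRel R #None None))))
  as [A HA].
assert (EA : forall s, s ∈c A <-> exists a, is_ordinal a /\ closure_stage s a).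
{ intro x; transitivity (exists a, hereditarily_transitive a /\ rel R x a);
    [exact (HA x)|].
  split; intros (a & Ha & K); exists a; split;
    first [apply is_ordinalE | apply HR]; assumption. }
apply EA; revert s; apply pair_induction; intros s IH; apply EA.
destruct (@earlier_name_dom s) as (l & Hl & L).
{ intros r u z Hr Hu Hz; apply EA, (IH r u z); auto. }
exists l; split; auto; intros q t; split; intro N;
  apply (stageE _ _ _ Hl); apply some_stage_forces_sub in N; revert N;
  apply forces_sub_mono; intros q' r r' Hr Hr'.
- apply L; exact Hr.
(* Here [s] is on the right, so the name with a known closure stage is [r'] and the two conclusions
   of [L] are interchanged. *)
- destruct (L q' r' r Hr'); auto.
Qed.

(** With closure stages for all names, one [l] bounds those needed for [s], and applying the
    operator to the union gives nothing at [s] beyond stage [l]. *)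
Lemma forces_sub_some_stage p s t :
  forces_sub some_stage p s t -> some_stage p s t.
Proof.
destruct (@earlier_name_dom s) as (l & Hl & K).
{ intros r _ _ _ _ _; apply closure_stage_exists. }
intro N; exists l; split; auto; apply (stageE _ _ _ Hl); revert N.
apply forces_sub_mono; intros q r r' Hr _; apply K; exact Hr.
Qed.

Lemma forces_sub_fixed_point : exists FSub : Cl, forall p s t,
  rel3 FSub p s t <-> forces_sub (rel3 FSub) p s t.
Proof.
destruct some_stage_class as [FSub HSub]; exists FSub; intros p s t.
rewrite (HSub p s t); split; intro K.
- apply some_stage_forces_sub in K; revert K; apply forces_sub_mono.
  intros; split; apply HSub.
- apply forces_sub_some_stage; revert K; apply forces_sub_mono.
  intros; split; apply HSub.
Qed.

End Operator.

(** * Classes for membership, equality and the dense witnesses *)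

Lemma forces_in_class (LE FSub : Cl) : exists FIn : Cl, forall p s t,
  rel3 FIn p s t <-> forces_in LE (rel3 FSub) p s t.
Proof.
apply rel3_class with (p := FForcesIn LE
  (fun I q a b => FTripleIn (FCMem None FSub) q a b) ##None #None None).
intros; reflexivity.
Qed.

Lemma forces_eq_class (FSub : Cl) : exists FEq : Cl, forall p s t,
  rel3 FEq p s t <-> rel3 FSub p s t /\ rel3 FSub p t s.
Proof.
apply rel3_class with (p := FAnd
  (FTripleIn (FCMem None FSub) ##None #None None)
  (FTripleIn (FCMem None FSub) ##None None #None)).
intros; reflexivity.
Qed.

(** The largest candidate for the dense class in clause (a). *)
Lemma dense_below_class (LE FEq : Cl) p s t : exists D : Cl, forall q,
  q ∈c D <-> rel LE q p /\ exists r c z,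
    is_opair z r c /\ z ∈ t /\ rel LE q c /\ rel3 FEq q s r.
Proof.
exact (class_of (FAnd (FRel LE None #p) (FEx (FEx (FEx
  (FAnd (FOpair None ##None #None) (FAnd (FMem None ####t)
  (FAnd (FRel LE ###None #None)
        (FTripleIn (FCMem None FEq) ###None ####s ##None))))))))).
Qed.

End Model.

(** * Verification of clauses (a)-(c) *)

Theorem theorem3 : forall M : structure, GBC M -> ETR_Ord M ->
  forall (P LE : vclass M) (one : vset M),
    class_forcing_notion P LE one -> admits_atomic_forcing_relation P LE.
Proof.
intros M G ETR P LE one (HLE & _ & Htrans & _).
(* [LE] relates only conditions, so the operator can leave membership in [P] implicit. *)
assert (HP : forall p q, rel LE p q -> p ∈c P /\ q ∈c P).
{ intros p q (z & Hz & K); destruct (HLE z K) as (p' & q' & Hp & Hq & Hz').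
  destruct (is_opair_inj Hz Hz'); subst; auto. }
destruct (ETR FSubStage LE) as (S & S1 & S2).
destruct (forces_sub_fixed_point G S1 S2) as [FSub HSub].
destruct (forces_in_class G LE FSub) as [FIn HIn].
destruct (forces_eq_class G FSub) as [FEq HEq].
exists FIn, FSub, FEq; intros p s t Hp _ _; split; [|split; [apply HEq|]].
- rewrite (HIn p s t); split.
  + intro K; destruct (dense_below_class G LE FEq p s t) as [D HD].
    exists D; split; [split|].
    * intros q Hq; apply HD in Hq; split; [apply (HP q p)|]; tauto.
    * intros q1 _ Hq1; destruct (K q1 Hq1) as
        (q2 & Hq2 & r & c & z & Hz & Hzt & Hc & K1 & K2).
      exists q2; split; auto; apply HD; split.
      { destruct (HP q2 q1 Hq2), (HP q1 p Hq1); apply (Htrans q2 q1 p); auto. }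
      exists r, c, z; repeat split; auto; apply HEq; auto.
    * intros q Hq; apply HD in Hq; tauto.
  (* An arbitrary dense witness [D] is met below each [q1], which recovers the pointwise form. *)
  + intros (D & [_ HD] & K) q1 Hq1; destruct (HP q1 p Hq1) as [Pq1 _].
    destruct (HD q1 Pq1 Hq1) as (q2 & Hq2 & Hq).
    destruct (K q2 Hq2) as (r & c & z & Hz & Hzt & Hc & E); apply HEq in E.
    exists q2; split; auto; exists r, c, z; tauto.
- rewrite (HSub p s t); split.
  + intros K r c z q' Hz Hzs _ Hq' Hc.
    destruct (K r c z q' Hz Hzs Hq' Hc) as (q & Hq & N).
    exists q; split; [apply (HP q q' Hq)|]; split; auto; apply HIn; exact N.
  + intros K r c z q' Hz Hzs Hq' Hc; destruct (HP q' p Hq') as [Pq' _].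
    destruct (K r c z q' Hz Hzs Pq' Hq' Hc) as (q & _ & Hq & N).
    exists q; split; auto; apply HIn; exact N.
Qed.
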